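(* Let $({\bf H}^n,{\bf E}^n)_{0\le n\le M}$ be the solution of the scheme $$\mu\,\frac{{\bf H}^{n+1}-{\bf H}^n}{\tau}=-\hat{\bf D}\,\frac{{\bf E}^{n+1}+{\bf E}^n}{2},\qquad \epsilon\,\frac{{\bf E}^{n+1}-{\bf E}^n}{\tau}=\hat{\bf D}\,\frac{{\bf H}^{n+1}+{\bf H}^n}{2},\qquad n=0,\dots,M-1 .$$ Then the following discrete energy conservation law holds: $$\mathcal E_3^{n+1}=\mathcal E_3^n,\qquad \mathcal E_3^n=\frac{\mu}{2}\|\hat\delta_t{\bf H}^{n-1/2}\|_h^2+\frac{\epsilon}{2}\|\hat\delta_t{\bf E}^{n-1/2}\|_h^2,\qquad n=1,\dots,M-1.$$
   Context: Grid: $N_x,N_y,N_z$ are even positive integers, the domain is $[x_L,x_R]\times[y_L,y_R]\times[z_L,z_R]$, $L_w=w_R-w_L$, $h_w=L_w/N_w$, $\mu_w=2\pi/L_w$ for $w\in\{x,y,z\}$; $w_j=w_L+(j-1)h_w$, $j=1,\dots,N_w$. Time step $\tau=T/M$, $T>0$, $M$ a positive integer. $\epsilon,\mu>0$ are constants and $c=1/\sqrt{\epsilon\mu}$. Put $s_1=N_xN_yN_z$. ${\bf D}_1^w\in\mathbb R^{N_w\times N_w}$ is the Fourier spectral first-order differentiation matrix: $({\bf D}_1^w)_{j,l}=\tfrac12\mu_w(-1)^{j+l}\cot\big(\mu_w\tfrac{w_j-w_l}{2}\big)$ for $j\ne l$, and $({\bf D}_1^w)_{j,j}=0$. Put ${\bf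 D}_1={\bf I}_{N_z}\otimes{\bf I}_{N_y}\otimes{\bf D}_1^x$, ${\bf D}_2={\bf I}_{N_z}\otimes{\bf D}_1^y\otimes{\bf I}_{N_x}$, ${\bf D}_3={\bf D}_1^z\otimes{\bf I}_{N_y}\otimes{\bf I}_{N_x}$ ($\otimes$ the Kronecker product), acting on grid functions $U_{j,k,m}$ ordered as vectors in $\mathbb R^{s_1}$ with $j$ varying fastest, then $k$, then $m$. Let $${\bf D}=\begin{pmatrix}0&-{\bf D}_3&{\bf D}_2\\ {\bf D}_3&0&-{\bf D}_1\\ -{\bf D}_2&{\bf D}_1&0\end{pmatrix},\qquad \hat{\bf D}={\bf D}+\frac{c^2\tau^2}{12}{\bf D}^3+\frac{c^4\tau^4}{120}{\bf D}^5 .$$ Unknowns ${\bf H}^n=(({\bf H}_x^n)^T,({\bf H}_y^n)^T,({\bf H}_z^n)^T)^T$ and ${\bf E}^n=(({\bf E}_x^n)^T,({\bf E}_y^n)^T,({\bf E}_z^n)^T)^T$ lie in $\mathbb R^{3s_1}$. For grid functions, $\langle{\bf U},{\bf V}\rangle_h=h_xh_yh_z\sum_{j,k,m}U_{j,k,m}\overline{V_{j,k,m}}$; for three-component vectors $\langle{\bf U},{\bf V}\rangle_h=\sum_{w\in\{x,y,z\}}\langle{\bf U}_w,{\bf V}_w\rangle_h$; $\|{\bf U}\|_h^2=\langle{\bf U},{\bf U}\rangle_h$. The difference quotient is $\hat\delta_t{\bf U}^{n-1/2}=({\bf U}^n-{\bf U}^{n-1})/\tau$. *)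

(* Defs.v *)
From HB Require Import structures.
From mathcomp Require Import all_boot all_order all_algebra.
From mathcomp Require Import all_classical all_reals all_analysis.
From mathcomp Require Import mxtens.

Set Implicit Arguments.
Unset Strict Implicit.
Unset Printing Implicit Defensive.

Import Order.TTheory GRing.Theory Num.Theory.
Local Open Scope ring_scope.

Section GridDefs.
Variable R : realType.

Definition cot (x : R) : R := cos x / sin x.

Definition mesh_size (wL wR : R) (N : nat) : R := (wR - wL) / N%:R.

Definition base_freq (wL wR : R) : R := 2 * pi / (wR - wL).

(* Indices run over 0, ..., N-1 instead of 1, ..., N; the parity of j + l,
   which gives the sign in [fourier_diff_mx], is unaffected by the shift. *)
Definition node (wL wR : R) (N : nat) (j : 'I_N) : R :=
  wL + j%:R * mesh_size wL wR N.

Definition fourier_diff_mx (wL wR : R) (N : nat) : 'M[R]_N :=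
  \matrix_(j < N, l < N)
    if j == l then 0
    else 2^-1 * base_freq wL wR * (-1) ^+ (j + l)
         * cot (base_freq wL wR * ((node wL wR j - node wL wR l) / 2)).

(* [*t] is the Kronecker product: entry (i1 * q + i2, j1 * q + j2) of
   A *t B, with q the size of B, is A i1 j1 * B i2 j2. *)
Definition diff_x (xL xR : R) (Nx Ny Nz : nat) : 'M[R]_(Nz * Ny * Nx) :=
  (1%:M : 'M[R]_Nz) *t (1%:M : 'M[R]_Ny) *t fourier_diff_mx xL xR Nx.

Definition diff_y (yL yR : R) (Nx Ny Nz : nat) : 'M[R]_(Nz * Ny * Nx) :=
  (1%:M : 'M[R]_Nz) *t fourier_diff_mx yL yR Ny *t (1%:M : 'M[R]_Nx).

Definition diff_z (zL zR : R) (Nx Ny Nz : nat) : 'M[R]_(Nz * Ny * Nx) :=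
  fourier_diff_mx zL zR Nz *t (1%:M : 'M[R]_Ny) *t (1%:M : 'M[R]_Nx).

Definition curl_mx (s : nat) (D1 D2 D3 : 'M[R]_s) : 'M[R]_(s + (s + s)) :=
  block_mx 0              (row_mx (- D3) D2)
           (col_mx D3
                   (- D2)) (block_mx 0 (- D1)
                                     D1 0).

Definition corrected_curl (n : nat) (D : 'M[R]_n) (c tau : R) : 'M[R]_n :=
  D + (c ^+ 2 * tau ^+ 2 / 12) *: D ^+ 3
    + (c ^+ 4 * tau ^+ 4 / 120) *: D ^+ 5.

(* The x-index j varies fastest, then k, then m. *)
Definition grid_val (Nx Ny Nz : nat) (U : 'cV[R]_(Nz * Ny * Nx))
    (j : 'I_Nx) (k : 'I_Ny) (m : 'I_Nz) : R :=
  U (mxtens_index (mxtens_index (m, k), j)) 0.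

(* Grid functions are real, so no conjugation appears. *)
Definition grid_dot (hx hy hz : R) (Nx Ny Nz : nat)
    (U V : 'cV[R]_(Nz * Ny * Nx)) : R :=
  hx * hy * hz *
  \sum_(j < Nx) \sum_(k < Ny) \sum_(m < Nz) grid_val U j k m * grid_val V j k m.

Definition comp_x (s : nat) (U : 'cV[R]_(s + (s + s))) : 'cV[R]_s := usubmx U.
Definition comp_y (s : nat) (U : 'cV[R]_(s + (s + s))) : 'cV[R]_s :=
  usubmx (dsubmx U).
Definition comp_z (s : nat) (U : 'cV[R]_(s + (s + s))) : 'cV[R]_s :=
  dsubmx (dsubmx U).

Definition field_dot (hx hy hz : R) (Nx Ny Nz : nat)
    (U V : 'cV[R]_(Nz * Ny * Nx + (Nz * Ny * Nx + Nz * Ny * Nx))) : R :=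
  grid_dot hx hy hz (comp_x U) (comp_x V)
  + grid_dot hx hy hz (comp_y U) (comp_y V)
  + grid_dot hx hy hz (comp_z U) (comp_z V).

Definition field_norm (hx hy hz : R) (Nx Ny Nz : nat)
    (U : 'cV[R]_(Nz * Ny * Nx + (Nz * Ny * Nx + Nz * Ny * Nx))) : R :=
  Num.sqrt (field_dot hx hy hz U U).

(* The difference quotient at time level n - 1/2; meaningful for n >= 1. *)
Definition diff_quot (V : lmodType R) (tau : R) (U : nat -> V) (n : nat) : V :=
  tau^-1 *: (U n - U n.-1).

(* Only the values at the time levels 0, ..., M are constrained. *)
Definition scheme_solution (d : nat) (eps mu tau : R) (M : nat) (D : 'M[R]_d)
    (H E : nat -> 'cV[R]_d) : Prop :=
  forall n : nat, (n < M)%N ->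
    mu *: (tau^-1 *: (H n.+1 - H n)) = - (D *m (2^-1 *: (E n.+1 + E n)))
    /\ eps *: (tau^-1 *: (E n.+1 - E n)) = D *m (2^-1 *: (H n.+1 + H n)).

Definition energy3 (hx hy hz eps mu tau : R) (Nx Ny Nz : nat)
    (H E : nat -> 'cV[R]_(Nz * Ny * Nx + (Nz * Ny * Nx + Nz * Ny * Nx)))
    (n : nat) : R :=
  mu / 2 * field_norm hx hy hz (diff_quot tau H n) ^+ 2
  + eps / 2 * field_norm hx hy hz (diff_quot tau E n) ^+ 2.

End GridDefs.

(* Main.v *)
Require Import Defs.
From HB Require Import structures.
From mathcomp Require Import all_boot all_order all_algebra.
From mathcomp Require Import all_classical all_reals all_analysis.
From mathcomp Require Import mxtens.
From mathcomp Require Import ring.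

Set Implicit Arguments.
Unset Strict Implicit.

Import Order.TTheory GRing.Theory Num.Theory.
Local Open Scope ring_scope.

(** Each one-dimensional Fourier differentiation matrix is antisymmetric, the
cotangent being odd, and so are its Kronecker products with identities.  The
curl block pattern is itself antisymmetric, hence [D] is symmetric, and so is
any combination of its powers: [corrected_curl D c tau] is symmetric
([curl_mx_sym], [corrected_curl_sym]).

A symmetric [D] makes the midpoint scheme conserve the quadratic energy
[mu * |H|^2 + eps * |E|^2]: testing the first equation with [H n.+1 + H n] and
the second with [E n.+1 + E n], the left-hand sides give the differences of
the squared norms while the two right-hand sides are opposite to each other
([scheme_energy_step]).  The scheme is linear with coefficients constant in
time, so the difference quotients of a solution solve the same scheme
([diff_quot_scheme]), and the energy in the theorem is, up to a constant
factor, the energy of that second solution, since the squared discrete norm is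
the squared Euclidean one times the cell volume ([field_normE]). *)

(** * Symmetry of the discrete curl *)

Lemma fourier_diff_mx_antisym (R : realType) (wL wR : R) (N : nat) :
  (fourier_diff_mx wL wR N)^T = - fourier_diff_mx wL wR N.
Proof.
apply/matrixP => j l; rewrite !mxE eq_sym.
case: eqVneq => _; first by rewrite oppr0.
rewrite addnC -mulrN; congr (_ * _).
rewrite -[X in _ * (X / 2)]opprB mulNr mulrN /cot.
by rewrite cosN sinN invrN mulrN.
Qed.

Lemma tensNmx (R : pzRingType) (m n p q : nat) (A : 'M[R]_(m, n))
    (B : 'M[R]_(p, q)) : (- A) *t B = - (A *t B).
Proof. by apply/matrixP => i j; rewrite !mxE mulNr. Qed.

Lemma tensmxN (R : pzRingType) (m n p q : nat) (A : 'M[R]_(m, n))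
    (B : 'M[R]_(p, q)) : A *t (- B) = - (A *t B).
Proof. by apply/matrixP => i j; rewrite !mxE mulrN. Qed.

Lemma diff_x_antisym (R : realType) (xL xR : R) (Nx Ny Nz : nat) :
  (diff_x xL xR Nx Ny Nz)^T = - diff_x xL xR Nx Ny Nz.
Proof. by rewrite !trmx_tens !trmx1 fourier_diff_mx_antisym tensmxN. Qed.

Lemma diff_y_antisym (R : realType) (yL yR : R) (Nx Ny Nz : nat) :
  (diff_y yL yR Nx Ny Nz)^T = - diff_y yL yR Nx Ny Nz.
Proof. by rewrite !trmx_tens !trmx1 fourier_diff_mx_antisym tensmxN tensNmx. Qed.

Lemma diff_z_antisym (R : realType) (zL zR : R) (Nx Ny Nz : nat) :
  (diff_z zL zR Nx Ny Nz)^T = - diff_z zL zR Nx Ny Nz.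
Proof. by rewrite !trmx_tens !trmx1 fourier_diff_mx_antisym !tensNmx. Qed.

(** Transposition exchanges each pair of mirror blocks, which carry opposite
signs, and the antisymmetry of the blocks cancels that sign. *)
Lemma curl_mx_sym (R : realType) (s : nat) (D1 D2 D3 : 'M[R]_s) :
  D1^T = - D1 -> D2^T = - D2 -> D3^T = - D3 ->
  (curl_mx D1 D2 D3)^T = curl_mx D1 D2 D3.
Proof.
move=> D1T D2T D3T; rewrite /curl_mx !tr_block_mx tr_row_mx tr_col_mx.
by rewrite !trmx0 !linearN /= D1T D2T D3T !opprK.
Qed.

Lemma trmx_exp (R : comPzRingType) (d : nat) (A : 'M[R]_d) (k : nat) :
  (A ^+ k)^T = A^T ^+ k.
Proof.
elim: k => [|k IHk]; first by rewrite !expr0 trmx1.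
by rewrite exprS exprSr -IHk; exact: trmx_mul.
Qed.

Lemma corrected_curl_sym (R : realType) (d : nat) (D : 'M[R]_d) (c tau : R) :
  D^T = D -> (corrected_curl D c tau)^T = corrected_curl D c tau.
Proof. by move=> DT; rewrite /corrected_curl !linearD !linearZ /= !trmx_exp DT. Qed.

(** * Energy conservation of the midpoint scheme *)

Definition vdot (R : realType) (d : nat) (u v : 'cV[R]_d) : R := (u^T *m v) 0 0.

Lemma vdotE (R : realType) (d : nat) (u v : 'cV[R]_d) :
  vdot u v = \sum_i u i 0 * v i 0.
Proof. by rewrite /vdot mxE; apply: eq_bigr => i _; rewrite mxE. Qed.

Lemma vdotC (R : realType) (d : nat) (u v : 'cV[R]_d) : vdot u v = vdot v u.
Proof. by rewrite !vdotE; apply: eq_bigr => i _; rewrite mulrC. Qed.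

Lemma vdotDl (R : realType) (d : nat) (u v w : 'cV[R]_d) :
  vdot (u + v) w = vdot u w + vdot v w.
Proof. by rewrite /vdot linearD mulmxDl mxE. Qed.

Lemma vdotNr (R : realType) (d : nat) (u v : 'cV[R]_d) :
  vdot u (- v) = - vdot u v.
Proof. by rewrite /vdot mulmxN mxE. Qed.

Lemma vdotBr (R : realType) (d : nat) (u v w : 'cV[R]_d) :
  vdot u (v - w) = vdot u v - vdot u w.
Proof. by rewrite /vdot mulmxBr !mxE. Qed.

Lemma vdotZr (R : realType) (d : nat) (k : R) (u v : 'cV[R]_d) :
  vdot u (k *: v) = k * vdot u v.
Proof. by rewrite /vdot -scalemxAr mxE. Qed.

Lemma vdot_sym_mx (R : realType) (d : nat) (D : 'M[R]_d) (u v : 'cV[R]_d) :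
  D^T = D -> vdot u (D *m v) = vdot v (D *m u).
Proof. by move=> DT; rewrite [RHS]vdotC /vdot trmx_mul DT mulmxA. Qed.

Lemma vdot_addsub (R : realType) (d : nat) (u v : 'cV[R]_d) :
  vdot (u + v) (u - v) = vdot u u - vdot v v.
Proof. by rewrite vdotBr !vdotDl [vdot v u]vdotC opprD addrA addrK. Qed.

(** Polarized as [|u'|^2 - |u|^2 = (u' + u) . (u' - u)], the energy increment
only involves the two right-hand sides, tested with the sums [h + h'] and
[e + e']; these contributions are opposite because [D] is symmetric. *)
Lemma scheme_energy_step (R : realType) (d M : nat) (eps mu tau : R)
    (D : 'M[R]_d) (H E : nat -> 'cV[R]_d) :
  tau != 0 -> D^T = D -> scheme_solution eps mu tau M D H E ->
  forall n : nat, (n < M)%N ->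
    mu * vdot (H n.+1) (H n.+1) + eps * vdot (E n.+1) (E n.+1)
    = mu * vdot (H n) (H n) + eps * vdot (E n) (E n).
Proof.
move=> tau0 DT sol n /sol[eqH eqE].
have incrH : mu * (vdot (H n.+1) (H n.+1) - vdot (H n) (H n))
    = - (tau / 2 * vdot (H n.+1 + H n) (D *m (E n.+1 + E n))).
  have := congr1 (vdot (H n.+1 + H n)) eqH.
  rewrite vdotNr -scalemxAr !vdotZr vdot_addsub => eqv.
  by rewrite -mulrA -mulrN -eqv; field.
have incrE : eps * (vdot (E n.+1) (E n.+1) - vdot (E n) (E n))
    = tau / 2 * vdot (H n.+1 + H n) (D *m (E n.+1 + E n)).
  have := congr1 (vdot (E n.+1 + E n)) eqE.
  rewrite -scalemxAr !vdotZr vdot_addsub [vdot _ (D *m _)]vdot_sym_mx // => eqv.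
  by rewrite -mulrA -eqv; field.
apply/eqP; rewrite -subr_eq0 opprD addrACA -!mulrBr incrH incrE.
by rewrite addNr.
Qed.

(** The index shift keeps every quotient at a level where it is meaningful;
one step is lost because a quotient involves two levels. *)
Lemma diff_quot_scheme (R : realType) (d M : nat) (eps mu tau : R)
    (D : 'M[R]_d) (H E : nat -> 'cV[R]_d) :
  scheme_solution eps mu tau M D H E ->
  scheme_solution eps mu tau (M - 1) D
    (fun n => diff_quot tau H n.+1) (fun n => diff_quot tau E n.+1).
Proof.
move=> sol n; rewrite ltn_subRL add1n => ltSnM.
have [eqH1 eqE1] := sol _ ltSnM; have [eqH0 eqE0] := sol _ (ltnW ltSnM).
have subZ (U : nat -> 'cV[R]_d) (k : R) :
    k *: (tau^-1 *: (diff_quot tau U n.+2 - diff_quot tau U n.+1))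
    = tau^-1 *: (k *: (tau^-1 *: (U n.+2 - U n.+1))
                 - k *: (tau^-1 *: (U n.+1 - U n))).
  by apply/matrixP => i j; rewrite /diff_quot !mxE; ring.
have addZ (U : nat -> 'cV[R]_d) :
    D *m (2^-1 *: (diff_quot tau U n.+2 + diff_quot tau U n.+1))
    = tau^-1 *: (D *m (2^-1 *: (U n.+2 + U n.+1))
                 - D *m (2^-1 *: (U n.+1 + U n))).
  rewrite -mulmxBr scalemxAr; congr (_ *m _).
  by apply/matrixP => i j; rewrite /diff_quot !mxE; ring.
by rewrite !subZ !addZ eqH1 eqH0 eqE1 eqE0 -scalerN opprB opprK addrC.
Qed.

(** * The discrete norm *)

Lemma sum_mxtens_index (R : nmodType) (m n : nat) (F : 'I_(m * n) -> R) :
  \sum_i F i = \sum_(k < m) \sum_(j < n) F (mxtens_index (k, j)).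
Proof.
rewrite pair_bigA (reindex (@mxtens_index m n)) /=; last first.
  by exists (@mxtens_unindex m n) => i _; rewrite ?mxtens_indexK ?mxtens_unindexK.
by apply: eq_bigr => -[].
Qed.

Lemma grid_dotE (R : realType) (hx hy hz : R) (Nx Ny Nz : nat)
    (U V : 'cV[R]_(Nz * Ny * Nx)) :
  grid_dot hx hy hz U V = hx * hy * hz * vdot U V.
Proof.
rewrite /grid_dot vdotE !sum_mxtens_index; congr (_ * _).
under eq_bigr => j _ do rewrite exchange_big.
rewrite exchange_big; apply: eq_bigr => m _.
by rewrite exchange_big.
Qed.

Lemma vdot_components (R : realType) (s : nat) (U V : 'cV[R]_(s + (s + s))) :
  vdot U V = vdot (comp_x U) (comp_x V) + vdot (comp_y U) (comp_y V)
             + vdot (comp_z U) (comp_z V).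
Proof.
rewrite !vdotE !big_split_ord /= addrA.
by congr (_ + _ + _); apply: eq_bigr => i _; rewrite !mxE.
Qed.

Lemma field_normE (R : realType) (hx hy hz : R) (Nx Ny Nz : nat)
    (U : 'cV[R]_(Nz * Ny * Nx + (Nz * Ny * Nx + Nz * Ny * Nx))) :
  0 <= hx * hy * hz -> field_norm hx hy hz U ^+ 2 = hx * hy * hz * vdot U U.
Proof.
move=> h_ge0.
have dotE : field_dot hx hy hz U U = hx * hy * hz * vdot U U.
  by rewrite /field_dot !grid_dotE vdot_components !mulrDr.
rewrite /field_norm dotE sqr_sqrtr // mulr_ge0 // vdotE.
by apply: sumr_ge0 => i _; rewrite -expr2 sqr_ge0.
Qed.

Lemma mesh_size_ge0 (R : realType) (wL wR : R) (N : nat) :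
  wL <= wR -> 0 <= mesh_size wL wR N.
Proof. by move=> lew; rewrite divr_ge0 ?subr_ge0. Qed.

(** * Conservation of the energy of the difference quotients *)

Theorem theorem4p3 (R : realType) (Nx Ny Nz M : nat)
    (xL xR yL yR zL zR T eps mu : R)
    (Nx_gt0 : (0 < Nx)%N) (Nx_even : ~~ odd Nx)
    (Ny_gt0 : (0 < Ny)%N) (Ny_even : ~~ odd Ny)
    (Nz_gt0 : (0 < Nz)%N) (Nz_even : ~~ odd Nz)
    (M_gt0 : (0 < M)%N)
    (ltx : xL < xR) (lty : yL < yR) (ltz : zL < zR)
    (T_gt0 : 0 < T) (eps_gt0 : 0 < eps) (mu_gt0 : 0 < mu)
    (H E : nat -> 'cV[R]_(Nz * Ny * Nx + (Nz * Ny * Nx + Nz * Ny * Nx))) :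
  let hx := mesh_size xL xR Nx in
  let hy := mesh_size yL yR Ny in
  let hz := mesh_size zL zR Nz in
  let tau := T / M%:R in
  let c := 1 / Num.sqrt (eps * mu) in
  let D := curl_mx (diff_x xL xR Nx Ny Nz) (diff_y yL yR Nx Ny Nz)
                   (diff_z zL zR Nx Ny Nz) in
  scheme_solution eps mu tau M (corrected_curl D c tau) H E ->
  forall n : nat, (1 <= n <= M - 1)%N ->
    energy3 hx hy hz eps mu tau H E n.+1 = energy3 hx hy hz eps mu tau H E n.
Proof.
move=> hx hy hz tau c D sol n /andP[n_gt0 len].
have tau0 : tau != 0 by rewrite gt_eqF // divr_gt0 // ltr0n.
have h_ge0 : 0 <= hx * hy * hz
  by apply: mulr_ge0; [apply: mulr_ge0|]; exact/mesh_size_ge0/ltW.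
have DT : (corrected_curl D c tau)^T = corrected_curl D c tau.
  apply/corrected_curl_sym/curl_mx_sym.
  - exact: diff_x_antisym.
  - exact: diff_y_antisym.
  - exact: diff_z_antisym.
case: n n_gt0 len => // n _ ltnM.
have := scheme_energy_step tau0 DT (diff_quot_scheme sol) ltnM.
set h' := diff_quot tau H n.+2; set e' := diff_quot tau E n.+2.
set h0 := diff_quot tau H n.+1; set e0 := diff_quot tau E n.+1 => step.
have energyE (u v : 'cV[R]_(Nz * Ny * Nx + (Nz * Ny * Nx + Nz * Ny * Nx))) :
    mu / 2 * (hx * hy * hz * vdot u u) + eps / 2 * (hx * hy * hz * vdot v v)
    = hx * hy * hz / 2 * (mu * vdot u u + eps * vdot v v) by ring.
by rewrite /energy3 !field_normE // !energyE step.
Qed.
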